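(* Let $f\in\mathsf{Pol}=\mathbb{Z}[x_1,x_2,\ldots]$. Define $f^{(0)}=f$ and, as long as $f^{(t)}\neq0$, let $\mathbf{x}^{\theta_t}$ be the $\prec$-largest monomial appearing in $f^{(t)}$, let $c_{\theta_t}\in\mathbb{Z}$ be its coefficient in $f^{(t)}$, and put $f^{(t+1)}=f^{(t)}-c_{\theta_t}J_{\theta_t}$. Then this procedure terminates after finitely many steps (some $f^{(t)}=0$); that is, the resulting expansion $f=\sum_\alpha g_\alpha J_\alpha$, with $g_{\theta_t}=c_{\theta_t}$, is a finite sum.
   Context: Here $\alpha$ ranges over $\mathbb{Z}_{\ge0}^\infty$, the sequences of nonnegative integers with finitely many nonzero entries, and $\mathbf{x}^\alpha=x_1^{\alpha_1}x_2^{\alpha_2}\cdots$. Order. $\prec$ is the pure reverse lexicographic total order on monomials, i.e. the opposite of the lexicographic order: $\mathbf{x}^\beta\prec\mathbf{x}^\alpha$ if and only if $\beta\ne\alpha$ and, for the smallest index $i$ with $\beta_i\neq\alpha_i$, one has $\beta_i>\alpha_i$. With respect to this order $J_\alpha=\mathbf{x}^\alpha+\sum_{\beta\prec\alpha}c_\beta\mathbf{x}^\beta$, where $\beta\prec\alpha$ means $\mathbf{x}^\beta\prec\mathbf{x}^\alpha$. The polynomials $J_\alpha$. The skyline diagram is $\mathtt{Skyline}(\alpha)=\{(i,y):1\le y\le\alpha_i\}\subset\mathbb{N}^2$, where $i$ indexes columns (left to right, starting at $1$) and $y$ indexes rows (bottom to top, starting at $1$); each of its positions is marked with a $+$. The $K$-Kohnert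 rule generates diagrams, whose occupied positions are each marked $+$ or $g$, starting from $\mathtt{Skyline}(\alpha)$ by sequentially (zero or more times) applying the following moves. Choose a $+$ that is the topmost occupied position (occupied by $+$ or $g$) of its column and such that there is an unoccupied position (no $+$ or $g$) in its row strictly to its left; let $p$ be the rightmost such unoccupied position. Then either (a) move this $+$ to $p$, leaving its original position empty; or (b) place a $+$ at $p$ and mark the original position with a $g$. The $g$'s never move. Let $\mathcal{D}(\alpha)$ be the set of all diagrams so obtained (including $\mathtt{Skyline}(\alpha)$ itself); a diagram resulting from several sequences of moves is counted once, while diagrams with the same occupied positions but different arrangements of $+$'s and $g$'s are distinct. For $D\in\mathcal{D}(\alpha)$ let $x^D=\prod_i x_i^{d_i}$, where $d_i$ is the number of occupied positions ($+$ or $g$) in column $i$ of $D$. Then $$J_\alpha=J_\alpha^{(-1)}=\sum_{D\in\mathcal{D}(\alpha)}(-1)^{\#\{g\text{'s in }D\}}\,x^D .$$ *)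

(* Defs.v *)
From HB Require Import structures.
From mathcomp Require Import all_boot all_order all_algebra.
From mathcomp Require Import finmap.
From mathcomp Require Export monalg.

Set Implicit Arguments.
Unset Strict Implicit.
Unset Printing Implicit Defensive.

Import GRing.Theory.
Local Open Scope ring_scope.

(* Variables, columns and rows are numbered from 0: index i stands for x_(i+1),
   resp. for the (i+1)-st column or row. *)

Notation mono := {cmonom nat}.

(* Z[x_1, x_2, ...] as the monoid algebra of the free commutative monoid on
   nat, i.e., finitely supported int-valued functions on monomials. *)
Notation Pol := {malg int[{cmonom nat}]}.

Definition X (i : nat) : Pol := << ucm i >>.

(* b is strictly smaller than a in the pure reverse lexicographic order. The
   smallest index where they differ satisfies a i < b i, so it lies in the
   support of b (see precP). *)
Definition prec (b a : mono) : bool :=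
  has (fun i => (a i < b i)%N && all (fun j => b j == a j) (iota 0 i))
      (finsupp b).

Lemma precP (b a : mono) :
  reflect (exists2 i, (a i < b i)%N & forall j, (j < i)%N -> b j = a j)
          (prec b a).
Proof.
apply: (iffP hasP) => [[i _ /andP[lt_ab /allP eq_ab]]|[i lt_ab eq_ab]].
  by exists i => // j lt_ji; apply/eqP/eq_ab; rewrite mem_iota.
exists i; first by rewrite -cmE_neq0 -lt0n (leq_ltn_trans _ lt_ab).
rewrite lt_ab; apply/allP => j; rewrite mem_iota add0n => /= lt_ji.
by rewrite eq_ab.
Qed.

(* The prec-largest monomial of f, when f != 0; it is 1 when f = 0. *)
Definition lead (f : Pol) : mono :=
  head (@mone mono)
    [seq a <- msupp f | all (fun b => (b == a) || prec b a) (msupp f)].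

(* A position (c, r) is in column c and row r; None means unoccupied. *)
Definition plus : option bool := Some true.
Definition ghost : option bool := Some false.
Notation diagram n m := {ffun 'I_n * 'I_m -> option bool}.

(* D has a topmost + at (c, r), and (p, r) is the rightmost unoccupied position
   of row r strictly to the left of column c. *)
Definition movable n m (D : diagram n m) (c p : 'I_n) (r : 'I_m) : bool :=
  [&& D (c, r) == plus,
      [forall r' : 'I_m, (r < r')%N ==> (D (c, r') == None)],
      (p < c)%N,
      D (p, r) == None
    & [forall k : 'I_n, (p < k < c)%N ==> (D (k, r) != None)]].

(* The + at (c, r) moves to (p, r), and z is what is left at (c, r). *)
Definition move n m (D : diagram n m) (c p : 'I_n) (r : 'I_m)
    (z : option bool) : diagram n m :=
  [ffun q => if q == (p, r) then plus else if q == (c, r) then z else D q].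

Definition kkohnert n m : rel (diagram n m) := fun D E =>
  [exists c : 'I_n, exists p : 'I_n, exists r : 'I_m,
    movable D c p r && ((E == move D c p r None) || (E == move D c p r ghost))].

(* A box containing the skyline diagram of a. The moves stay inside it, as they
   only add positions to the left of a position in the same row. *)
Definition ncols (a : mono) : nat := (\max_(i <- finsupp a) i.+1)%N.
Definition nrows (a : mono) : nat := (\max_(i <- finsupp a) a i)%N.

Definition skyline (a : mono) : diagram (ncols a) (nrows a) :=
  [ffun q : 'I_(ncols a) * 'I_(nrows a) =>
    if (q.2 < a q.1)%N then plus else None].

Definition xdiag n m (D : diagram n m) : Pol :=
  \prod_(i < n) X i ^+ #|[set r : 'I_m | D (i, r) != None]|.

Definition J (a : mono) : Pol :=
  \sum_(D : diagram (ncols a) (nrows a) | connect (@kkohnert _ _) (skyline a) D)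
    (-1) ^+ #|[set q | D q == ghost]| * xdiag D.

Definition reduce (f : Pol) : Pol :=
  if f == 0 then 0 else f - f@_(lead f) *: J (lead f).

(* f^(t), which stays equal to 0 once the procedure has stopped. *)
Definition remainder (f : Pol) (t : nat) : Pol := iter t reduce f.

Definition theta (f : Pol) (t : nat) : mono := lead (remainder f t).

Definition ctheta (f : Pol) (t : nat) : int := (remainder f t)@_(theta f t).

(* Main.v *)
Require Import Defs.
From mathcomp Require Import all_boot all_order all_algebra.
From mathcomp Require Import finmap.

(** Two facts about a polynomial [J a] make the procedure stop.

    It is unitriangular: every K-Kohnert move puts a new [+] in a column strictly
    to the left of everything else it alters, so the exponent vector of the
    diagram gains in column [p] and is unchanged before [p]; that is exactly a
    strict decrease for [prec] ([prec_move]). Hence only the skyline diagram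
    contributes to the monomial [a], with coefficient 1 ([lead_coef_J]), and all
    other monomials of [J a] are smaller ([msupp_J]). A reduction step therefore
    kills the leading monomial and creates only smaller ones.

    Smaller alone does not suffice: [prec] is not well founded, and the moves
    that leave a [g] behind raise the degree. But no diagram leaves the box that
    holds the skyline of [a], so the monomials of [J a] have their columns and
    exponents bounded by those of [a]. All remainders of [f] thus live on the
    monomials of one box that holds the monomials of [f], and there are finitely
    many of them ([Jclosed_box]). Every step strictly shrinks the set of
    monomials still available, and induction on its size builds the expansion
    along with the proof of termination ([expansion_in]). *)

Set Implicit Arguments.
Unset Strict Implicit.
Unset Printing Implicit Defensive.

Local Open Scope ring_scope.

Import GRing.Theory.

(** * The order on monomials *)

Lemma prec_irr (a : mono) : prec a a = false.
Proof. by apply/negP => /precP[i]; rewrite ltnn. Qed.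

Lemma prec_trans (b a c : mono) : prec a b -> prec b c -> prec a c.
Proof.
move=> /precP[i lt_i eq_i] /precP[j lt_j eq_j]; apply/precP.
case: (ltngtP i j) => [ij|ji|eij].
- exists i => [|k ki]; first by rewrite -eq_j.
  by rewrite eq_i ?eq_j ?(ltn_trans ki ij).
- exists j => [|k kj]; first by rewrite eq_i.
  by rewrite eq_i ?eq_j ?(ltn_trans kj ji).
- subst j; exists i => [|k ki]; first exact: ltn_trans lt_j lt_i.
  by rewrite eq_i ?eq_j.
Qed.

Lemma prec_total (a b : mono) : [|| a == b, prec a b | prec b a].
Proof.
have [//|ne_ab] /= := boolP (a == b).
have ex_ne : exists i, a i != b i.
  have [/allP eq_ab|/allPn[i _ ne_i]] :=
    boolP (all (fun i => a i == b i) (finsupp a ++ finsupp b)); last by exists i.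
  case/cmP: ne_ab => i; apply/eqP.
  have [i_in|] := boolP (i \in (finsupp a ++ finsupp b)); first exact: eq_ab.
  by rewrite mem_cat negb_or -!cmE_eq0 => /andP[/eqP-> /eqP->].
(* The first index where the exponents differ decides the comparison. *)
case: (ex_minnP ex_ne) => i ne_i min_i.
have eq_lt j : (j < i)%N -> a j = b j.
  by move=> ji; apply/eqP; apply: contraLR ji => /min_i; rewrite -leqNgt.
have [lt_i|lt_i|eq_i] := ltngtP (a i) (b i).
- by apply/orP; right; apply/precP; exists i => // j /eq_lt.
- by apply/orP; left; apply/precP; exists i.
- by rewrite eq_i eqxx in ne_i.
Qed.

Lemma has_prec_max (s : seq mono) :
  s != [::] -> has (fun a => all (fun b => (b == a) || prec b a) s) s.
Proof.
elim: s => // x s IH _; have [->|/IH /hasP[a a_s /allP max_a]] := eqVneq s [::].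
  by rewrite /= eqxx.
have /or3P[/eqP ex|lt_x|lt_a] := prec_total x a.
- by apply/hasP; exists a; rewrite /= ?ex ?mem_head // eqxx; apply/allP.
- apply/hasP; exists a; first by rewrite inE a_s orbT.
  by rewrite /= lt_x orbT; apply/allP.
- apply/hasP; exists x; first exact: mem_head.
  rewrite /= eqxx; apply/allP => b /max_a.
  by case/predU1P=> [->|lt_b]; rewrite ?lt_a ?(prec_trans lt_b lt_a) orbT.
Qed.

Lemma leadP (f : Pol) : f != 0 ->
  lead f \in msupp f /\ {in msupp f, forall b, b = lead f \/ prec b (lead f)}.
Proof.
move=> f0; have : has (fun a => all (fun b => (b == a) || prec b a) (msupp f))
                      (msupp f).
  apply: has_prec_max; apply: contraNneq f0 => supp0.
  by rewrite -msupp_eq0 -cardfs_eq0 supp0.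
rewrite has_filter /lead.
set s := [seq _ <- _ | _]; case def_s: s => [//|a s'] _ /=.
have : a \in s by rewrite def_s mem_head.
rewrite mem_filter => /andP[/allP max_a a_f]; split=> // b /max_a.
by case/predU1P; [left | right].
Qed.

(** * The monomial of a diagram *)

(** The exponent vector of [xdiag D], as a product over occupied positions so
    that the effect of a move can be read off two factors. *)
Definition content n m (D : diagram n m) : mono :=
  \big[@mmul mono/@mone mono]_(q | D q != None) ucm (q.1 : nat).

Lemma xdiag_content n m (D : diagram n m) : xdiag D = << content D >>.
Proof.
have -> : << content D >> = \prod_(q | D q != None) X q.1 :> Pol.
  apply: (big_morph (fun a : mono => << a >> : Pol)) => [a b|//].
  by rewrite malgM_def fgmulUU mulr1.
rewrite (eq_bigl (fun q => D (q.1, q.2) != None)); last by case.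
rewrite -(pair_big_dep xpredT (fun i r => D (i, r) != None)
                       (fun i _ => X i)) /=.
apply: eq_bigr => i _; rewrite prodr_const; congr (_ ^+ _).
by apply: eq_card => r; rewrite !inE.
Qed.

Lemma contentE n m (D : diagram n m) k :
  content D k = (\sum_(i < n | i == k :> nat) #|[set r | D (i, r) != None]|)%N.
Proof.
rewrite /content (big_morph (fun a : mono => a k) (cmM k) (cm1 k)).
rewrite (eq_bigl (fun q => D (q.1, q.2) != None)); last by case.
rewrite -(pair_big_dep xpredT (fun i r => D (i, r) != None)
                       (fun i _ => ucm (i : nat) k)) /=.
rewrite [RHS]big_mkcond /=; apply: eq_bigr => i _.
rewrite cmU sum_nat_const; case: eqP => _ /=; rewrite ?muln0 ?muln1 //.
by apply: eq_card => r; rewrite !inE.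
Qed.

(** The factor [k < N] makes the exponents vanish outside the first [N] variables. *)
Definition fits N M (a : mono) := forall k, (a k <= (k < N) * M)%N.

Lemma fits_content n m (D : diagram n m) : fits n m (content D).
Proof.
move=> k; rewrite contentE; case: ltnP => [lt_kn|le_nk].
  rewrite (big_pred1 (Ordinal lt_kn)) => [|i]; last by rewrite /= -val_eqE.
  by rewrite mul1n -[leqRHS]card_ord max_card.
by rewrite big_pred0 // => i; rewrite ltn_eqF // (leq_trans _ le_nk).
Qed.

Lemma fitsE N M (a : mono) : (ncols a <= N)%N /\ (nrows a <= M)%N <-> fits N M a.
Proof.
split=> [[le_N le_M] k|fit_a].
  have [k_a|] := boolP (k \in finsupp a); last by rewrite -cmE_eq0 => /eqP->.
  have lt_kN : (k < N)%N.
    by apply: leq_trans le_N; apply: (leq_bigmax_seq _ k_a).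
  rewrite lt_kN mul1n; apply: leq_trans le_M.
  exact: (leq_bigmax_seq _ k_a).
split; apply/bigmax_leqP_seq => k k_a _; have := fit_a k; last first.
  by move=> /leq_trans; apply; case: ltnP; rewrite ?mul1n.
by case: ltnP => // _; rewrite mul0n leqn0 cmE_eq0 k_a.
Qed.

(** In any box that is large enough for it, the skyline of [a] has content [a].
    Besides identifying the leading monomial of [J a], this shows that the
    monomials that fit a box are the contents of its diagrams. *)
Lemma content_skyline_box N M (a : mono) : fits N M a ->
  content [ffun q : 'I_N * 'I_M => if (q.2 < a q.1)%N then plus else None] = a.
Proof.
move=> fit_a; apply/eqP/cmP => k; rewrite contentE.
have := fit_a k; case: ltnP => [lt_kN|le_Nk].
  rewrite mul1n => le_aM.
  rewrite (big_pred1 (Ordinal lt_kN)) => [|i]; last by rewrite /= -val_eqE.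
  transitivity #|[set widen_ord le_aM r | r : 'I_(a k)]|; last first.
    rewrite card_imset ?card_ord // => r s /(congr1 val) /=; exact: val_inj.
  apply: eq_card => r; rewrite inE ffunE /=.
  apply/idP/imsetP => [|[s _ ->]]; last by rewrite /= ltn_ord.
  by case: ltnP => // lt_r _; exists (Ordinal lt_r); last exact: val_inj.
rewrite mul0n leqn0 => /eqP->.
by rewrite big_pred0 // => i; rewrite ltn_eqF // (leq_trans _ le_Nk).
Qed.

Lemma content_skyline (a : mono) : content (skyline a) = a.
Proof. by apply: content_skyline_box; apply/fitsE. Qed.

(** Both kinds of move multiply the content by [x_p]; when nothing is left behind
    it is also divided by [x_c], a factor that is put on the left here because
    monomials have no inverses. *)
Lemma content_move n m (D : diagram n m) (c p : 'I_n) (r : 'I_m) z :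
    movable D c p r ->
  mmul (content (move D c p r z)) (if z == None then ucm (c : nat) else mone)
    = mmul (content D) (ucm (p : nat)).
Proof.
case/and5P=> /eqP Dc _ lt_pc /eqP Dp _.
have ne_cp : (c, r) != (p, r) by rewrite xpair_eqE -val_eqE /= gtn_eqF.
(* Only the factors at (p, r) and (c, r) change. *)
have split2 (E : diagram n m) : content E =
    mmul (if E (p, r) != None then ucm (p : nat) else mone)
      (mmul (if E (c, r) != None then ucm (c : nat) else mone)
         (\big[@mmul mono/@mone mono]_(q | (q != (p, r)) && (q != (c, r)))
            if E q != None then ucm (q.1 : nat) else mone)).
  by rewrite /content big_mkcond (bigD1 (p, r)) //= (bigD1 (c, r)).
rewrite !split2 !ffunE Dp Dc (negPf ne_cp) !eqxx /= mul1m.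
set A := \big[_/_]_(q | _) _; set B := \big[_/_]_(q | _) _.
have -> : A = B.
  apply: eq_bigr => q /andP[ne_p ne_c].
  by rewrite ffunE (negPf ne_p) (negPf ne_c).
rewrite [RHS]mulmC -mulmA; congr mmul.
by case: eqP => _; rewrite /= ?mul1m ?mulm1 // mulmC.
Qed.

(** * Unitriangularity and boundedness of J *)

(** Column [p] gains one position, and the only column that may lose one lies
    to its right, where it cannot influence the comparison. *)
Lemma prec_move n m (D : diagram n m) (c p : 'I_n) (r : 'I_m) z :
  movable D c p r -> prec (content (move D c p r z)) (content D).
Proof.
move=> mov; have lt_pc : (p < c)%N by case/and5P: mov.
have cE k : (content (move D c p r z) k + (z == None) * (c == k :> nat)
             = content D k + (p == k :> nat))%N.
  rewrite -(cmU (p : nat) k) -cmM -(content_move z mov) cmM.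
  by case: eqP => _; rewrite ?cmU ?cm1 ?mul1n.
apply/precP; exists (p : nat) => [|k lt_kp].
  by move: (cE p); rewrite eqxx (gtn_eqF lt_pc) muln0 addn0 => ->; rewrite addn1.
have := cE k; rewrite (gtn_eqF lt_kp) (gtn_eqF (ltn_trans lt_kp lt_pc)).
by rewrite muln0 !addn0.
Qed.

Lemma prec_connect n m (D E : diagram n m) :
  connect (@kkohnert n m) D E -> E = D \/ prec (content E) (content D).
Proof.
case/connectP=> s path_s ->; elim: s D path_s => [|F s IH] D /=; first by left.
case/andP=> /existsP[c /existsP[p /existsP[r /andP[mov DF]]]] /IH lt_F; right.
have {DF} lt_FD : prec (content F) (content D).
  by case/orP: DF => /eqP->; apply: prec_move.
by case: lt_F => [->//|lt_F]; apply: prec_trans lt_FD.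
Qed.

Lemma mcoeff_signed k (a b : mono) :
  ((-1) ^+ k * << a >> : Pol)@_b = if a == b then (-1) ^+ k else 0.
Proof.
elim: k => [|k IH]; first by rewrite !expr0 mul1r mcoeffU1; case: eqP.
by rewrite !exprS -mulrA !mulN1r mcoeffN IH; case: ifP; rewrite ?oppr0.
Qed.

Lemma mcoeff_J (a b : mono) :
  (J a)@_b = \sum_(D : diagram (ncols a) (nrows a)
                     | connect (@kkohnert _ _) (skyline a) D && (content D == b))
               (-1) ^+ #|[set q | D q == ghost]|.
Proof.
rewrite /J raddf_sum big_mkcondr /=; apply: eq_bigr => D _.
by rewrite xdiag_content mcoeff_signed.
Qed.

(** Any other reachable diagram has a strictly smaller content, and the skyline
    has no [g]. *)
Lemma lead_coef_J (a : mono) : (J a)@_a = 1.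
Proof.
rewrite mcoeff_J (big_pred1 (skyline a)) => [|D].
  rewrite (_ : [set q | _] = set0) ?cards0 //.
  by apply/setP => q; rewrite !inE ffunE; case: ifP.
apply/andP/eqP => [[/prec_connect[//|]]|->].
  by rewrite content_skyline => + /eqP eq_a; rewrite eq_a prec_irr.
by rewrite connect0 content_skyline.
Qed.

Lemma msupp_J (a b : mono) : b \in msupp (J a) ->
  (b = a \/ prec b a) /\ fits (ncols a) (nrows a) b.
Proof.
rewrite -mcoeff_neq0 mcoeff_J => nz.
have [D /andP[reach /eqP <-]|none] := pickP (fun D : diagram (ncols a) (nrows a) =>
    connect (@kkohnert _ _) (skyline a) D && (content D == b)).
  split; last exact: fits_content.
  by case: (prec_connect reach) => [->|]; rewrite content_skyline; [left|right].
by rewrite big_pred0 ?eqxx in nz.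
Qed.

(** * Termination *)

Definition Jclosed (D : seq mono) :=
  {in D, forall a, {subset msupp (J a) <= D}}.

(** The contents of the diagrams of a box enumerate the monomials that fit it, so
    this is the finite set in which the whole procedure takes place. *)
Lemma Jclosed_box N M :
  Jclosed [seq content D | D : diagram N M].
Proof.
move=> _ /imageP[D _ ->] b /msupp_J[_ fit_b].
have /fitsE[le_N le_M] := @fits_content _ _ D.
have {}fit_b : fits N M b.
  apply/fitsE; move: fit_b => /fitsE[le_n le_m].
  by split; [apply: leq_trans le_N | apply: leq_trans le_M].
by rewrite -(content_skyline_box fit_b) image_f.
Qed.

(** Closure survives truncation because [J] is triangular; this is what lets the
    induction of [expansion_in] pass from [D] to the part of [D] below the leading
    monomial. *)
Lemma Jclosed_prec (D : seq mono) a :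
  Jclosed D -> Jclosed [seq b <- D | prec b a].
Proof.
move=> cl b; rewrite mem_filter => /andP[lt_b b_D] d d_b.
rewrite mem_filter (cl b) // andbT.
have [[->//|lt_d] _] := msupp_J d_b.
exact: prec_trans lt_b.
Qed.

(** The leading terms cancel as [J] has leading coefficient 1, and what [J]
    introduces is smaller and stays in [D]. *)
Lemma msupp_reduce (D : seq mono) (f : Pol) :
    f != 0 -> Jclosed D -> {subset msupp f <= D} ->
  {subset msupp (reduce f) <= [seq b <- D | prec b (lead f)]}.
Proof.
move=> f0 cl sub b; have [lead_f max_f] := leadP f0.
rewrite /reduce (negPf f0) -mcoeff_neq0 mcoeffB mcoeffZ => nz.
have ne_b : b != lead f.
  by apply: contraNneq nz => ->; rewrite lead_coef_J mulr1 subrr.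
have [b_f|] := boolP (b \in msupp f).
  rewrite mem_filter sub // andbT.
  by case: (max_f b b_f) ne_b => [->|//]; rewrite eqxx.
rewrite -mcoeff_eq0 => /eqP fb; rewrite fb sub0r oppr_eq0 in nz.
have b_J : b \in msupp (J (lead f)).
  by rewrite -mcoeff_neq0; apply: contraNneq nz => ->; rewrite mulr0.
rewrite mem_filter (cl _ (sub _ lead_f)) // andbT.
by case: (msupp_J b_J) => -[eb|//] _; rewrite eb eqxx in ne_b.
Qed.

(** Induction on the size of [D]: after one step the remainder lives on the
    members of [D] below [lead f], which exclude [lead f] itself. The clause on
    the support of [g] keeps the expansion of that remainder inside this smaller
    set, so the coefficient of [lead f] can be added to it without overwriting
    another one. *)
Lemma expansion_in (D : seq mono) (f : Pol) :
    Jclosed D -> {subset msupp f <= D} ->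
  exists T : nat,
    [/\ remainder f T = 0,
        forall t : nat, (t < T)%N -> remainder f t <> 0
      & exists g : {fsfun mono -> int with 0},
          [/\ {subset finsupp g <= D},
              forall t : nat, (t < T)%N -> g (theta f t) = ctheta f t,
              forall a : mono,
                (forall t : nat, (t < T)%N -> a <> theta f t) -> g a = 0
            & f = \sum_(a <- finsupp g) g a *: J a]].
Proof.
have [n] := ubnP (size D); elim: n => // n IH in D f *.
rewrite ltnS => le_n cl sub; have [->|f0] := eqVneq f 0.
  exists 0%N; split=> //; exists [fsfun with 0]; split=> //.
  - by move=> a; rewrite finsupp0.
  - by move=> a _; rewrite fsfun0E.
  - by rewrite finsupp0 big_seq_fset0.
have [lead_f _] := leadP f0; set a := lead f in lead_f.
set D' := [seq b <- D | prec b a].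
have lt_D' : (size D' < n)%N.
  apply: leq_trans le_n; rewrite size_filter -(count_predC (prec^~ a) D).
  rewrite -addn1 leq_add2l -has_count; apply/hasP; exists a; first exact: sub.
  by rewrite /= prec_irr.
have [T [rem0 rem_nz [g [g_D' g_theta g_out g_sum]]]] :=
  IH D' _ lt_D' (@Jclosed_prec D a cl) (@msupp_reduce D f f0 cl sub).
have remS t : remainder f t.+1 = remainder (reduce f) t.
  by rewrite /remainder iterSr.
have a_g : a \notin finsupp g.
  by apply/negP => /g_D'; rewrite mem_filter prec_irr.
have c_nz : f@_a != 0 by rewrite mcoeff_neq0.
exists T.+1; split; first by rewrite remS.
  by case=> [_|t /rem_nz]; [apply/eqP | rewrite remS].
exists [fsfun g with a |-> f@_a].
have supp_g : finsupp [fsfun g with a |-> f@_a] = (a |` finsupp g)%fset.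
  by rewrite finsupp_with (negPf c_nz).
split.
- move=> b; rewrite supp_g in_fset1U => /predU1P[->|/g_D'].
    exact: sub.
  by rewrite mem_filter => /andP[].
- case=> [_|t lt_t]; first by rewrite fsfun_with.
  have thS : theta f t.+1 = theta (reduce f) t by rewrite /theta remS.
  rewrite fsfun_withE thS /ctheta thS remS -/(ctheta _ _) -g_theta //.
  (* No later leading monomial equals a: their coefficients are nonzero, so they
     all lie in the support of g. *)
  case: eqP => // eq_a; case/negP: a_g; rewrite -eq_a mem_finsupp g_theta //.
  by rewrite mcoeff_neq0; apply: (leadP _).1; apply/eqP/rem_nz.
- move=> b out; rewrite fsfun_withE; case: eqP => [eq_b|_].
    by case: (out 0%N).
  by apply: g_out => t lt_t eq_b; apply: (out t.+1); rewrite // /theta remS.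
- rewrite supp_g big_fsetU1 //= fsfun_with.
  have -> : \sum_(b <- finsupp g) [fsfun g with a |-> f@_a] b *: J b
          = \sum_(b <- finsupp g) g b *: J b.
    apply: eq_big_seq => b b_g; rewrite fsfun_withE ifN //.
    by apply: contraNneq a_g => <-.
  by rewrite -g_sum /reduce (negPf f0) addrC subrK.
Qed.

Theorem proposition3p1 (f : Pol) :
  exists T : nat,
    [/\ remainder f T = 0,
        forall t : nat, (t < T)%N -> remainder f t <> 0
      & exists g : {fsfun mono -> int with 0},
          [/\ forall t : nat, (t < T)%N -> g (theta f t) = ctheta f t,
              forall a : mono,
                (forall t : nat, (t < T)%N -> a <> theta f t) -> g a = 0
            & f = \sum_(a <- finsupp g) g a *: J a]].
Proof.
pose N := (\max_(a <- msupp f) ncols a)%N.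
pose M := (\max_(a <- msupp f) nrows a)%N.
have sub : {subset msupp f <= [seq content D | D : diagram N M]}.
  move=> a a_f; have fit_a : fits N M a.
    apply/fitsE; split; first exact: (leq_bigmax_seq _ a_f).
    exact: (leq_bigmax_seq _ a_f).
  by rewrite -(content_skyline_box fit_a) image_f.
have [T [rem0 rem_nz [g [_ g_theta g_out g_sum]]]] :=
  expansion_in (@Jclosed_box N M) sub.
by exists T; split=> //; exists g.
Qed.
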